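(* $$\frac{512\sqrt{3}}{81} = \sum_{k=0}^{\infty}\left(\frac1{64}\right)^{k}\frac{\left(-\frac16\right)_k\left(\frac76\right)_k\left(\frac32\right)_k}{(1)_k\left(\frac43\right)_k\left(\frac53\right)_k}\,(14k+11).$$
   Context: For $k\in\mathbb{N}_0$, $(\alpha)_k=\alpha(\alpha+1)\cdots(\alpha+k-1)$ is the rising factorial (Pochhammer symbol), with $(\alpha)_0=1$. *)

(* Defs.v *)
From Stdlib Require Import Reals.
Open Scope R_scope.

Fixpoint pochhammer (a : R) (k : nat) : R :=
  match k with
  | O => 1
  | S j => pochhammer a j * (a + INR j)
  end.

(* Main.v *)
(** Let c_n = (1/2)_n / n! / 4^n and c_(-1) = 0.  Grouping Pochhammer symbols in threes shows
    that the k-th summand is a rational multiple of c_(3k+2), and it equals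
    256/27 (c_(3k) + c_(3k+1) + c_(3k+2)) + 128/27 (c_(3k+2) - c_(3k-1)).
    The second bracket telescopes to a null sequence, so the sum is 256/27 times
    the Newton series of (1 - x)^(-1/2) at x = 1/4, that is 256/27 * 2/sqrt 3. *)

Require Import Defs.
From Stdlib Require Import Reals Lra Lia.
From Coquelicot Require Import Coquelicot.
Open Scope R_scope.

Lemma pochhammer_pos (a : R) (k : nat) : 0 < a -> 0 < pochhammer a k.
Proof.
  intros Ha; induction k as [|k IH]; simpl; [lra|].
  apply Rmult_lt_0_compat; [assumption|].
  generalize (pos_INR k); lra.
Qed.

(** The Taylor coefficients of (1 - x)^(-a) at 0, with n! written as the Pochhammer symbol of 1. *)
Definition newton_coef (a : R) (n : nat) : R := pochhammer a n / pochhammer 1 n.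

Lemma newton_coef_pos (a : R) (n : nat) : 0 < a -> 0 < newton_coef a n.
Proof.
  intros Ha; apply Rdiv_lt_0_compat; apply pochhammer_pos; lra.
Qed.

Lemma newton_coef_S (a : R) (n : nat) :
  newton_coef a (S n) = newton_coef a n * ((a + INR n) / (1 + INR n)).
Proof.
  unfold newton_coef; simpl pochhammer; field; split.
  - generalize (pos_INR n); lra.
  - apply Rgt_not_eq, pochhammer_pos; lra.
Qed.

Lemma CV_radius_newton_coef (a : R) : 0 < a -> CV_radius (newton_coef a) = Finite 1.
Proof.
  intros Ha.
  rewrite (CV_radius_finite_DAlembert _ 1).
  - now rewrite Rinv_1.
  - intros n; apply Rgt_not_eq, newton_coef_pos, Ha.
  - lra.
  (* The ratio of consecutive coefficients, (a + n) / (1 + n), is split as 1 + (a - 1) / (n + 1). *)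
  - apply is_lim_seq_ext with (fun n => 1 + (a - 1) * / INR (S n)).
    + intros n; rewrite newton_coef_S.
      generalize (pos_INR n) (newton_coef_pos a n Ha); intros Hn Hb.
      rewrite Rabs_pos_eq.
      * rewrite S_INR; field; split; lra.
      * apply Rlt_le, Rdiv_lt_0_compat; [|assumption].
        apply Rmult_lt_0_compat; [assumption|].
        apply Rdiv_lt_0_compat; lra.
    + replace (Finite 1) with (Finite (1 + (a - 1) * 0)) by (f_equal; ring).
      apply is_lim_seq_plus'; [apply is_lim_seq_const|].
      apply (is_lim_seq_scal_l _ (a - 1) (Finite 0)).
      apply -> (is_lim_seq_incr_1 (fun n => / INR n)).
      apply (is_lim_seq_inv INR p_infty); [apply is_lim_seq_INR|discriminate].
Qed.

(** With b_n the coefficients, comparing powers of x in f' = a f + x f' leaves (n + 1) b_(n+1) = (a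
    + n) b_n, which is [newton_coef_S]. *)
Lemma PSeries_newton_ode (a x : R) : 0 < a -> Rabs x < 1 ->
  (1 - x) * PSeries (PS_derive (newton_coef a)) x = a * PSeries (newton_coef a) x.
Proof.
  intros Ha Hx.
  assert (Hcv : ex_pseries (newton_coef a) x).
  { apply CV_radius_inside; now rewrite CV_radius_newton_coef. }
  assert (Hcv' : ex_pseries (PS_derive (newton_coef a)) x).
  { apply CV_radius_inside; now rewrite CV_radius_derive, CV_radius_newton_coef. }
  enough (H : PSeries (PS_derive (newton_coef a)) x
              = a * PSeries (newton_coef a) x
                + x * PSeries (PS_derive (newton_coef a)) x) by lra.
  rewrite <- PSeries_incr_1, <- PSeries_scal, <- PSeries_plus.
  - apply PSeries_ext; intros n.
    unfold PS_plus, PS_scal, PS_derive; rewrite newton_coef_S.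
    change plus with Rplus; change scal with Rmult.
    (* Multiplication by x shifts the coefficients and puts 0 at index 0, so that index is treated
       apart. *)
    destruct n as [|n]; unfold PS_incr_1.
    + change zero with 0; simpl; field.
    + rewrite !S_INR; generalize (pos_INR n); intros; field; lra.
  - now apply ex_pseries_scal; [apply Rmult_comm|].
  - now apply ex_pseries_incr_1.
Qed.

(** By the differential equation, the product of the series with (1 - t)^a has derivative 0 on (-1,
    1), so it keeps its value 1 at t = 0. *)
Lemma is_pseries_newton (a x : R) : 0 < a -> Rabs x < 1 ->
  is_pseries (newton_coef a) x (Rpower (1 - x) (- a)).
Proof.
  intros Ha Hx.
  assert (Hcv : ex_pseries (newton_coef a) x).
  { apply CV_radius_inside; now rewrite CV_radius_newton_coef. }
  set (h := fun t => PSeries (newton_coef a) t * Rpower (1 - t) a).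
  assert (Hd : forall t, Rabs t < 1 -> is_derive h t 0).
  { intros t Ht.
    assert (H1 : 0 < 1 - t) by (apply Rabs_def2 in Ht; lra).
    assert (Hr : Rbar_lt (Rabs t) (CV_radius (newton_coef a)))
      by (now rewrite CV_radius_newton_coef).
    assert (Hp : is_derive (fun t => Rpower (1 - t) a) t (- a / (1 - t) * Rpower (1 - t) a)).
    { unfold Rpower; auto_derive; [exact H1|].
      change (1 + - t) with (1 - t); field; lra. }
    evar_last.
    - apply (is_derive_mult (PSeries (newton_coef a)) (fun t => Rpower (1 - t) a)).
      + apply is_derive_PSeries, Hr.
      + exact Hp.
      + intros; apply Rmult_comm.
    - change plus with Rplus; change mult with Rmult.
      generalize (PSeries_newton_ode a t Ha Ht); intros E.
      replace (PSeries (PS_derive (newton_coef a)) t)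
        with (a * PSeries (newton_coef a) t / (1 - t)) by (rewrite <- E; field; lra).
      field; lra. }
  assert (Hh : h x = h 0).
  { destruct (Rtotal_order x 0) as [Hlt|[->|Hgt]]; [|reflexivity|].
    - apply (eq_is_derive h x 0); [|exact Hlt].
      intros t Ht; apply Hd; apply Rabs_def2 in Hx; apply Rabs_def1; lra.
    - symmetry; apply (eq_is_derive h 0 x); [|exact Hgt].
      intros t Ht; apply Hd; apply Rabs_def2 in Hx; apply Rabs_def1; lra. }
  assert (H0 : h 0 = 1).
  { unfold h; rewrite PSeries_0, Rminus_0_r; unfold Rpower.
    rewrite ln_1, Rmult_0_r, exp_0; unfold newton_coef; simpl; field. }
  rewrite H0 in Hh; unfold h in Hh.
  rewrite Rpower_Ropp.
  replace (/ Rpower (1 - x) a) with (PSeries (newton_coef a) x).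
  - now apply PSeries_correct.
  - apply (Rmult_eq_reg_r (Rpower (1 - x) a)); [|apply Rgt_not_eq, exp_pos].
    rewrite Hh, Rinv_l; [reflexivity|apply Rgt_not_eq, exp_pos].
Qed.

(** The c_n of the outline. *)
Definition quarter_term (n : nat) : R := newton_coef (1 / 2) n * (1 / 4) ^ n.

Lemma quarter_term_S (n : nat) :
  quarter_term (S n) = quarter_term n * ((2 * INR n + 1) / (8 * (INR n + 1))).
Proof.
  unfold quarter_term; rewrite newton_coef_S; simpl pow.
  generalize (pos_INR n); intros; field; lra.
Qed.

Lemma is_series_quarter_term : is_series quarter_term (2 / sqrt 3).
Proof.
  assert (Hs : 0 < sqrt 3) by (apply sqrt_lt_R0; lra).
  replace (2 / sqrt 3) with (Rpower (1 - 1 / 4) (- (1 / 2))).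
  - apply is_series_ext with (fun n => scal (pow_n (1 / 4) n) (newton_coef (1 / 2) n)).
    + intros n; rewrite pow_n_pow; apply Rmult_comm.
    + apply (is_pseries_newton (1 / 2) (1 / 4)); [lra|].
      rewrite Rabs_pos_eq; lra.
  - rewrite Rpower_Ropp.
    replace (1 / 2) with (/ 2) by field.
    rewrite Rpower_sqrt by lra.
    (* The denominator 4 is written as a square so that its root simplifies to 2. *)
    replace (1 - 1 / 4) with (3 / (2 * 2)) by field.
    rewrite sqrt_div_alt, sqrt_square by lra.
    field; lra.
Qed.

Definition quarter_block (k : nat) : R :=
  (1 / 64) ^ k
  * ((pochhammer (- (1 / 6)) k * pochhammer (7 / 6) k * pochhammer (3 / 2) k)
     / (pochhammer 1 k * pochhammer (4 / 3) k * pochhammer (5 / 3) k)).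

(* (5/6)_k (7/6)_k (3/2)_k and (1)_k (4/3)_k (5/3)_k are 27^(-k) times
   (5/2)_(3k) and (3k+2)!/2; replacing (5/6)_k by (-1/6)_k costs the factor
   -1/(6k-1). *)
Lemma quarter_block_eq (k : nat) :
  quarter_block k * (6 * INR k - 1) = - (128 / 3) * quarter_term (3 * k + 2).
Proof.
  induction k as [|k IH].
  - unfold quarter_block, quarter_term, newton_coef; simpl; field.
  - replace (3 * S k + 2)%nat with (S (S (S (3 * k + 2)))) by lia.
    rewrite !quarter_term_S, !S_INR, plus_INR, mult_INR.
    set (q := quarter_term _) in *.
    (* Solving the induction hypothesis for [q] avoids dividing by 6k - 1; this factor then matches
       the new factor k - 1/6 of the symbol of -1/6. *)
    replace q with (- (3 / 128) * (quarter_block k * (6 * INR k - 1)))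
      by (rewrite IH; field).
    unfold quarter_block; simpl pochhammer; simpl pow; simpl (INR 3); simpl (INR 2).
    generalize (pos_INR k); intros; field.
    repeat split; try lra; apply Rgt_not_eq, pochhammer_pos; lra.
Qed.

(** Each summand adds three consecutive c_n; of the telescoping differences only the last term
    survives, since c_(-1) = 0. *)
Lemma sum_quarter_block (K : nat) :
  sum_n (fun k => quarter_block k * (14 * INR k + 11)) K
  = 256 / 27 * sum_n quarter_term (3 * K + 2) + 128 / 27 * quarter_term (3 * K + 2).
Proof.
  induction K as [|K IH].
  - rewrite sum_O; simpl (3 * 0 + 2)%nat; rewrite !sum_Sn, sum_O.
    change plus with Rplus.
    unfold quarter_block, quarter_term, newton_coef; simpl; field.
  - rewrite sum_Sn, IH.
    generalize (quarter_block_eq (S K)).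
    replace (3 * S K + 2)%nat with (S (S (S (3 * K + 2)))) by lia.
    rewrite !sum_Sn, !quarter_term_S, !S_INR, plus_INR, mult_INR.
    change plus with Rplus; simpl (INR 3); simpl (INR 2).
    set (q := quarter_term _); set (s := sum_n _ _); set (b := quarter_block _).
    generalize (pos_INR K); intros HK E.
    (* The factor 6(K + 1) - 1 = 6K + 5 is positive, and multiplying by it lets [E] eliminate
       [b]. *)
    apply (Rmult_eq_reg_r (6 * (INR K + 1) - 1)); [|lra].
    rewrite Rmult_plus_distr_r, (Rmult_assoc b), (Rmult_comm (14 * _ + _)), <- (Rmult_assoc b), E.
    field; lra.
Qed.

Theorem mainTheorem11 :
  is_series
    (fun k : nat =>
       (1 / 64) ^ k
       * ((pochhammer (- (1 / 6)) k * pochhammer (7 / 6) k * pochhammer (3 / 2) k)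
          / (pochhammer 1 k * pochhammer (4 / 3) k * pochhammer (5 / 3) k))
       * (14 * INR k + 11))
    (512 * sqrt 3 / 81).
Proof.
  change (is_lim_seq (sum_n (fun k => quarter_block k * (14 * INR k + 11)))
            (512 * sqrt 3 / 81)).
  apply is_lim_seq_ext with (1 := fun K => eq_sym (sum_quarter_block K)).
  assert (Hs : sqrt 3 <> 0) by (apply Rgt_not_eq, sqrt_lt_R0; lra).
  (* The limit is split to match the partial sums: Newton's series plus the vanishing telescoped
     term. *)
  replace (512 * sqrt 3 / 81) with (256 / 27 * (2 / sqrt 3) + 128 / 27 * 0).
  2:{ replace (512 * sqrt 3 / 81) with (512 * (sqrt 3 * sqrt 3) / (81 * sqrt 3))
        by (field; exact Hs).
      rewrite sqrt_sqrt by lra; field; exact Hs. }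
  (* The partial sums run along the indices 3K + 2 only, so both limits are taken on this
     subsequence. *)
  assert (Hsub : filterlim (fun K => (3 * K + 2)%nat) eventually eventually).
  { apply eventually_subseq; intros n; lia. }
  apply is_lim_seq_plus'.
  - apply (is_lim_seq_scal_l _ _ (Finite (2 / sqrt 3))).
    apply (is_lim_seq_subseq (sum_n quarter_term)); [exact Hsub|].
    exact is_series_quarter_term.
  - apply (is_lim_seq_scal_l _ _ (Finite 0)).
    apply (is_lim_seq_subseq quarter_term); [exact Hsub|].
    apply ex_series_lim_0; eexists; exact is_series_quarter_term.
Qed.
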